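(* Let $E$ be a KB-space with a quasi-interior point $e$, let $\Theta=(T_n)_{n\in\mathbb N}$ be a positive LR-sequence on $E$, let $W$ be a weakly compact subset of $E$, and let $\eta\in\mathbb R$ with $0\le\eta<1$. Suppose that $$\lim_{n\to\infty}\mathrm{dist}(T_n x,\,W+\eta B_E)=0\quad\text{for every }x\in B_E .$$ Then $\Theta$ converges strongly.
   Context: A Banach lattice $E$ is a KB-space if every increasing norm-bounded sequence in the positive cone $E_+=\{x\in E: x\ge 0\}$ is norm convergent. An element $e\in E_+$ is a quasi-interior point if the order ideal $E_e=\bigcup_{n\ge 0}[-ne,ne]$ is norm dense in $E$, where $[-x,x]=\{y\in E:|y|\le x\}$. $B_E=\{z\in E:\|z\|\le 1\}$, and $\mathrm{dist}(y,C)=\inf_{c\in C}\|y-c\|$. A sequence $\Theta=(T_n)_{n\in\mathbb N}$ of bounded linear operators on a Banach space $X$ is an LR-sequence if: (1) $\sup_n\|T_n\|<\infty$; (2) $\lim_{n\to\infty}\|T_n(T_m-I)x\|=0$ for every $m\in\mathbb N$ and every $x\in X$; (3) $\lim_{n\to\infty}\|(T_m-I)T_nx\|=0$ for every $m\in\mathbb N$ and every $x\in X$. It is positive (on a Banach lattice) if $T_nx\ge 0$ for all $x\ge 0$ and all $n$. $\Theta$ converges strongly if the norm limit $\lim_{n\to\infty}T_nx$ exists for every $x\in X$. *)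

(* Defs.v *)
From HB Require Import structures.
From mathcomp Require Import all_boot all_order all_algebra.
From mathcomp Require Import all_classical all_reals all_analysis.

Set Implicit Arguments.
Unset Strict Implicit.
Unset Printing Implicit Defensive.

Import Order.TTheory GRing.Theory Num.Theory.
Import numFieldNormedType.Exports.

Local Open Scope classical_set_scope.
Local Open Scope ring_scope.

(* Hierarchy Builder refuses a direct join of [CompleteNormedModule] with
   [Order.Lattice] (a numDomainType inherits from parts of both), so the lattice
   order is part of the mixin and the library's [latticeType] structure is
   derived from it below.  Norm monotonicity is |x| <= |y| -> ||x|| <= ||y||
   with |x| = x \/ -x. *)
HB.mixin Record isBanachLattice (R : realType) E of CompleteNormedModule R E := {
  vle : rel E ;
  vmeet : E -> E -> E ;
  vjoin : E -> E -> E ;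
  vle_refl : reflexive vle ;
  vle_anti : antisymmetric vle ;
  vle_trans : transitive vle ;
  vmeetP : forall x y z : E, vle x (vmeet y z) = vle x y && vle x z ;
  vjoinP : forall x y z : E, vle (vjoin x y) z = vle x z && vle y z ;
  vle_add2r : forall z x y : E, vle x y -> vle (x + z) (y + z) ;
  vle_scale2l : forall (a : R) (x y : E),
    0 <= a -> vle x y -> vle (a *: x) (a *: y) ;
  vle_norm : forall x y : E,
    vle (vjoin x (- x)) (vjoin y (- y)) -> `|x| <= `|y|
}.

#[short(type="banachLatticeType")]
HB.structure Definition BanachLattice (R : realType) :=
  { E of CompleteNormedModule R E & isBanachLattice R E }.

(* The order is put at [ring_display], so that [<=] in [ring_scope] is the
   order of E. *)
HB.instance Definition _ (R : realType) (E : banachLatticeType R) :=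
  Order.Le_isPOrder.Build ring_display (BanachLattice.sort E)
    (@vle_refl R E) (@vle_anti R E) (@vle_trans R E).
HB.instance Definition _ (R : realType) (E : banachLatticeType R) :=
  Order.POrder_MeetJoin_isLattice.Build ring_display (BanachLattice.sort E)
    (@vmeetP R E) (@vjoinP R E).

Section BanachSpace.
Context {R : realType} {X : completeNormedModType R}.

Definition unit_ball : set X := [set x | `|x| <= 1].

(* Valued in \bar R: the distance to the empty set is +oo (whereas in R,
   [inf set0] is 0). *)
Definition dist (y : X) (C : set X) : \bar R :=
  ereal_inf [set `|y - c|%:E | c in C].

Definition ball_enlargement (W : set X) (eta : R) : set X :=
  [set w + eta *: z | w in W & z in unit_ball].

Definition opnorm (T : X -> X) : \bar R :=
  ereal_sup [set `|T x|%:E | x in unit_ball].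

Definition bounded_operator (T : {linear X -> X}) : Prop :=
  (opnorm T < +oo)%E.

Record LR_sequence (T : nat -> {linear X -> X}) : Prop := {
  LR_operator : forall n, bounded_operator (T n) ;
  LR_bounded : (ereal_sup [set opnorm (T n) | n in [set: nat]] < +oo)%E ;
  LR_right : forall (m : nat) (x : X),
    `|T n (T m x - x)| @[n --> \oo] --> (0 : R) ;
  LR_left : forall (m : nat) (x : X),
    `|T m (T n x) - T n x| @[n --> \oo] --> (0 : R)
}.

Definition strongly_convergent (T : nat -> {linear X -> X}) : Prop :=
  forall x : X, cvg (T n x @[n --> \oo]).

Definition dual : Type :=
  {f : {linear X -> R^o} | continuous (f : X -> R^o)}.

Definition weak_topology : topologicalType :=
  sup_topology
    (fun f : dual => Topological.class (initial_topology (sval f : X -> R^o))).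

Definition weakly_compact (W : set X) : Prop :=
  compact (W : set weak_topology).

End BanachSpace.

Arguments dual {R} X.
Arguments weak_topology {R} X.

Section BanachLattice.
Context {R : realType} {E : banachLatticeType R}.

(* In [ring_scope], `|x| is always the norm. *)
Definition modulus (x : E) : E := Order.join x (- x).

(* [-x, x] *)
Definition sym_interval (x : E) : set E := [set y | modulus y <= x].

Definition order_ideal (e : E) : set E := \bigcup_n sym_interval (e *+ n).

Definition quasi_interior_point (e : E) : Prop :=
  0 <= e /\ dense (order_ideal e).

Definition positive_sequence (T : nat -> {linear E -> E}) : Prop :=
  forall (n : nat) (x : E), 0 <= x -> 0 <= T n x.

End BanachLattice.

Definition KB_space {R : realType} (E : banachLatticeType R) : Prop :=
  forall u : nat -> E, (forall n, 0 <= u n) -> nondecreasing_seq u ->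
    bounded_fun u -> cvg (u n @[n --> \oo]).

(* Main.v *)
Require Import Defs.
From HB Require Import structures.
From mathcomp Require Import all_boot all_order all_algebra.
From mathcomp Require Import all_classical all_reals all_analysis.
From mathcomp Require Import ring lra.

Set Implicit Arguments.
Unset Strict Implicit.
Unset Printing Implicit Defensive.

Import Order.TTheory GRing.Theory Num.Theory.
Import numFieldNormedType.Exports.

Local Open Scope classical_set_scope.
Local Open Scope ring_scope.

(* If T_m p <= p for all m and p >= 0, then T_n p decreases, up to errors
   tending to 0, hence converges.  So it suffices to approximate the orbit of
   x >= 0 by such subinvariant vectors.  Let r(x) be the infimum of the r such
   that, for some w in E, every tail of the orbit of x has convex combinations
   within r + eps of w.  Weak compactness of W and Mazur's lemma give
   r(x) <= eta ||x|| for all x, and r(x) = r(z - p) whenever z is a convex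
   combination of the orbit of x and T_n p converges.  For x >= 0 and w as above,
   convex combinations z_k of the tails with ||z_k - w|| <= r + eps satisfy
   ||z_k - inf(z_k, w^+)|| <= r + eps; passing to further convex combinations, the
   elements of the order interval [0, w^+] subtracted here converge in norm to
   some g.  The supremum p of the vectors obtained from g by joins and the T_m is
   subinvariant and satisfies ||z_k - p|| <= r + 2 eps for large k.  Hence
   r(x) <= eta (r(x) + 2 eps), so r(x) = 0 and T_n x is Cauchy.

   Sequences in an order interval [0, u] of a KB-space have convergent convex
   combinations because some positive functional f is small on v in [0, u] only
   if ||v|| is, and v |-> f(v^2), where v^2 is the supremum of its tangents
   2lv - l^2 u, satisfies a parallelogram inequality. *)

(** * The Hahn-Banach theorem *)

Section HahnBanach.
Context {R : realType} {V : lmodType R}.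
Implicit Types (p q : V -> R) (C : set V).

Definition sublinear p :=
  (forall x y, p (x + y) <= p x + p y) /\
  (forall a x, 0 <= a -> p (a *: x) <= a * p x).

Lemma sublinear0 p : sublinear p -> p 0 = 0.
Proof.
move=> [pD pZ]; apply/eqP; rewrite eq_le; apply/andP; split.
  by have := pZ 0 0 (lexx _); rewrite scale0r mul0r.
by have := pD 0 0; rewrite addr0; lra.
Qed.

Lemma sublinear_ge p x : sublinear p -> - p (- x) <= p x.
Proof. by move=> sp; have := sp.1 x (- x); rewrite subrr sublinear0//; lra. Qed.

(** This is the chain condition for Zorn's lemma. The bound [- p (- x)] keeps the pointwise infima
    finite; of two members of the chain, the smaller one serves both summands in subadditivity. *)
Lemma sublinear_inf_chain p (A : set (V -> R)) :
  A !=set0 -> (forall q, A q -> sublinear q) ->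
  (forall q x, A q -> - p (- x) <= q x) ->
  (forall q1 q2, A q1 -> A q2 ->
     (forall x, q1 x <= q2 x) \/ (forall x, q2 x <= q1 x)) ->
  exists2 q, sublinear q & forall q' x, A q' -> q x <= q' x.
Proof.
move=> [q0 Aq0] Asub Alb Atot.
pose I x := [set q x | q in A].
have I0 x : I x !=set0 by exists (q0 x), q0.
have le_I q x : A q -> inf (I x) <= q x.
  move=> Aq; apply: ge_inf; last by exists q.
  by exists (- p (- x)) => _ [q' Aq' <-]; exact: Alb.
exists (fun x => inf (I x)) => //; split.
- move=> x y; rewrite -lerBlDl; apply: lb_le_inf => // _ [q2 Aq2 <-].
  rewrite lerBlDl -lerBlDr; apply: lb_le_inf => // _ [q1 Aq1 <-].
  rewrite lerBlDr.
  have [l12|l21] := Atot _ _ Aq1 Aq2.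
    apply: le_trans (le_I _ _ Aq1) _; apply: le_trans ((Asub _ Aq1).1 _ _) _.
    by rewrite lerD2l.
  apply: le_trans (le_I _ _ Aq2) _; apply: le_trans ((Asub _ Aq2).1 _ _) _.
  by rewrite lerD2r.
- move=> a x; rewrite le_eqVlt => /orP[/eqP <-|a0].
    rewrite scale0r mul0r; apply: le_trans (le_I _ _ Aq0) _.
    by rewrite sublinear0//; exact: Asub.
  rewrite -ler_pdivrMl//; apply: lb_le_inf => // _ [q Aq <-].
  rewrite ler_pdivrMl//; apply: le_trans (le_I _ _ Aq) _.
  by apply: (Asub _ Aq).2; exact: ltW.
Qed.

Lemma minimal_sublinear p : sublinear p ->
  exists q, [/\ sublinear q, forall x, q x <= p x &
    forall q', sublinear q' -> (forall x, q' x <= q x) ->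
      forall x, q x <= q' x].
Proof.
move=> sp.
pose T := {q : V -> R | sublinear q /\ forall x, q x <= p x}.
pose p0 : T := exist _ p (conj sp (fun x => lexx _)).
pose Rel (q1 q2 : T) := `[< forall x, sval q2 x <= sval q1 x >].
have [|||[q [sq qp]] qmin] := @ZL_preorder T p0 Rel.
- by move=> t; apply/asboolP.
- move=> r s t /asboolP rs /asboolP st; apply/asboolP => x.
  exact: le_trans (st x) (rs x).
- move=> A Atot; have [->|/set0P[t0 At0]] := eqVneq A set0; first by exists p0.
  have [|q [t At <-]|q x [t At <-]|q1 q2 [t1 At1 <-] [t2 At2 <-]|q sq qA] :=
    @sublinear_inf_chain p (sval @` A).
  + by exists (sval t0), t0.
  + exact: (svalP t).1.
  + apply: le_trans (sublinear_ge _ (svalP t).1).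
    by rewrite lerN2; exact: (svalP t).2.
  + by have [/asboolP|/asboolP] := Atot _ _ At1 At2; [right|left].
  have qp x : q x <= p x.
    apply: le_trans (qA (sval t0) x _) ((svalP t0).2 x); by exists t0.
  exists (exist _ q (conj sq qp)) => s As; apply/asboolP => x /=.
  by apply: qA; exists s.
exists q; split=> // q' sq' q'q.
have q'p x : q' x <= p x by exact: le_trans (q'q x) (qp x).
have /qmin/asboolP // : Rel (exist _ q (conj sq qp)) (exist _ q' (conj sq' q'p)).
by apply/asboolP.
Qed.

Definition convex C := forall (t : R) x y, 0 <= t <= 1 -> C x -> C y ->
  C (t *: x + (1 - t) *: y).

Lemma convex_comb C (s t : R) x y : convex C -> C x -> C y -> 0 <= s -> 0 <= t ->
  exists2 z, C z & s *: x + t *: y = (s + t) *: z.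
Proof.
move=> cC Cx Cy s0 t0; have [st0|st0] := eqVneq (s + t) 0.
  have -> : s = 0 by lra.
  have -> : t = 0 by lra.
  by exists x => //; rewrite addr0 !scale0r addr0.
have st : 0 < s + t by rewrite lt_neqAle eq_sym st0 addr_ge0.
exists ((s / (s + t)) *: x + (1 - s / (s + t)) *: y).
  apply: cC => //; rewrite divr_ge0 ?addr_ge0//=.
  by rewrite ler_pdivrMr// mul1r lerDl.
rewrite scalerDr !scalerA mulrBr mulr1 mulrCA divff// mulr1.
by rewrite (addrC s) addrK.
Qed.

(** Take for [q x] the infimum of [p (x + t *: y) - t * c] over [t >= 0] and [y] in [C]. A linear
    functional below [q] is at least [c] on [C], so separation reduces to finding one. *)
Lemma sublinear_push p C (c : R) : sublinear p -> convex C -> C !=set0 ->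
  (forall y, C y -> c <= p y) ->
  exists q, [/\ sublinear q, forall x, q x <= p x &
                forall y, C y -> q (- y) <= - c].
Proof.
move=> sp cC [y0 Cy0] cp.
pose I x := [set z | exists t y, [/\ 0 <= t, C y & z = p (x + t *: y) - t * c]].
have I0 x : I x !=set0 by exists (p (x + 0 *: y0) - 0 * c), 0, y0.
have le_I x t y : 0 <= t -> C y -> inf (I x) <= p (x + t *: y) - t * c.
  move=> t0 Cy; apply: ge_inf; last by exists t, y.
  exists (- p (- x)) => _ [s [z [s0 Cz ->]]].
  have := sp.1 (x + s *: z) (- x); rewrite addrAC subrr add0r => h.
  suff : s * c <= p (s *: z) by lra.
  have [->|s1] := eqVneq s 0; first by rewrite mul0r scale0r sublinear0.
  have s2 : 0 < s by rewrite lt_neqAle eq_sym s1.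
  (* Homogeneity is assumed only as [p (a *: x) <= a * p x]; scaling by the inverse gives the
     reverse inequality. *)
  have := sp.2 s^-1 (s *: z); rewrite invr_ge0 scalerA mulVf// scale1r.
  move=> /(_ s0) h2; rewrite -ler_pdivlMl//; exact: le_trans (cp _ Cz) h2.
exists (fun x => inf (I x)); split.
- split=> [x y|a x a0].
    rewrite -lerBlDl; apply: lb_le_inf => // _ [t [z [t0 Cz ->]]].
    rewrite lerBlDl -lerBlDr; apply: lb_le_inf => // _ [s [v [s0 Cv ->]]].
    rewrite lerBlDr.
    have [e Ce ee] := convex_comb cC Cv Cz s0 t0.
    apply: le_trans (le_I _ _ _ (addr_ge0 s0 t0) Ce) _.
    rewrite -ee addrACA; have := sp.1 (x + s *: v) (y + t *: z); lra.
  move: a0; rewrite le_eqVlt => /orP[/eqP <-|a0].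
    rewrite scale0r mul0r; apply: le_trans (le_I _ 0 _ (lexx _) Cy0) _.
    by rewrite scale0r addr0 mul0r sublinear0// subr0.
  rewrite -ler_pdivrMl//; apply: lb_le_inf => // _ [t [y [t0 Cy ->]]].
  rewrite ler_pdivrMl//.
  apply: le_trans (le_I _ (a * t) _ (mulr_ge0 (ltW a0) t0) Cy) _.
  rewrite -scalerA -scalerDr mulrBr mulrA lerD2r.
  by apply: sp.2; exact: ltW.
- move=> x; apply: le_trans (le_I _ 0 _ (lexx _) Cy0) _.
  by rewrite scale0r addr0 mul0r subr0.
- move=> y Cy; apply: le_trans (le_I _ 1 _ ler01 Cy) _.
  by rewrite scale1r addNr mul1r sublinear0// add0r.
Qed.

(* Minimal sublinear functionals are linear, by [sublinear_push] applied to
   singletons. *)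
Theorem hahn_banach p C (c : R) : sublinear p -> convex C -> C !=set0 ->
  (forall y, C y -> c <= p y) ->
  exists f : {linear V -> R^o}, (forall x, f x <= p x) /\
    (forall y, C y -> c <= f y).
Proof.
move=> sp cC C0 cp.
have [q [sq qp qc]] := sublinear_push sp cC C0 cp.
have [g [sg gq gmin]] := minimal_sublinear sq.
have gN y : g (- y) = - g y.
  apply/eqP; rewrite eq_le lerNl sublinear_ge// andbT.
  have [||x -> //|h [sh hg hy]] := @sublinear_push g [set y] (g y) sg.
  - by move=> t x z _ /= -> ->; rewrite -scalerDl addrC subrK scale1r.
  - by exists y.
  exact: le_trans (gmin _ sh hg _) (hy _ erefl).
have gD x y : g (x + y) = g x + g y.
  apply/eqP; rewrite eq_le sg.1/= -lerN2 -gN !opprD -!gN.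
  exact: sg.1.
have gZ a x : g (a *: x) = a * g x.
  wlog a0 : a / 0 <= a => [H|].
    case: (leP 0 a) => [/H//|/ltW a0].
    by rewrite -[a]opprK scaleNr gN H ?oppr_ge0// !mulNr.
  apply/eqP; rewrite eq_le sg.2//=.
  by rewrite -lerN2 -gN -scalerN -mulrN -gN sg.2.
have gL : linear (g : V -> R^o) by move=> a x y; rewrite gD gZ.
pose gl := GRing.isLinear.Build R V R^o *:%R g gL.
pose G : {linear V -> R^o} := HB.pack g gl.
exists G; split=> [x|y Cy]; first exact: le_trans (gq x) (qp x).
have := le_trans (gq (- y)) (qc _ Cy); rewrite gN /=; lra.
Qed.

End HahnBanach.

(** * Banach lattices *)

Section VectorLattice.
Context {R : realType} {E : banachLatticeType R}.
Implicit Types (x y z : E) (a : R).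
Local Notation join := Order.join.
Local Notation meet := Order.meet.

Lemma levD2r z x y : (x + z <= y + z) = (x <= y).
Proof.
apply/idP/idP; last exact: vle_add2r.
by move=> /(@vle_add2r _ _ (- z)); rewrite !addrK.
Qed.

Lemma levD2l z x y : (z + x <= z + y) = (x <= y).
Proof. by rewrite ![z + _]addrC levD2r. Qed.

Lemma levD x y z t : x <= y -> z <= t -> x + z <= y + t.
Proof. by move=> xy zt; rewrite (@le_trans _ _ (y + z)) ?levD2r ?levD2l. Qed.

Lemma levBrDr x y z : (x <= y - z) = (x + z <= y).
Proof. by rewrite -[LHS](levD2r z) subrK. Qed.

Lemma levBlDr x y z : (x - y <= z) = (x <= z + y).
Proof. by rewrite -[LHS](levD2r y) subrK. Qed.

Lemma levBC x y z : (x - y <= z) = (x - z <= y).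
Proof. by rewrite !levBlDr addrC. Qed.

Lemma subv_ge0 x y : (0 <= y - x) = (x <= y).
Proof. by rewrite levBrDr add0r. Qed.

Lemma levN2 x y : (- x <= - y) = (y <= x).
Proof. by rewrite -[LHS]subv_ge0 opprK addrC subv_ge0. Qed.

Lemma oppv_le0 x : (- x <= 0) = (0 <= x).
Proof. by rewrite -{1}oppr0 levN2. Qed.

Lemma addv_ge0 x y : 0 <= x -> 0 <= y -> 0 <= x + y.
Proof. by move=> x0 y0; rewrite -[0]addr0 levD. Qed.

Lemma levZ2l a x y : 0 <= a -> x <= y -> a *: x <= a *: y.
Proof. exact: vle_scale2l. Qed.

Lemma scalev_ge0 a x : 0 <= a -> 0 <= x -> 0 <= a *: x.
Proof. by move=> a0 /(levZ2l a0); rewrite scaler0. Qed.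

Lemma levZ2r a b x : 0 <= x -> a <= b -> a *: x <= b *: x.
Proof.
by move=> x0 ab; rewrite -subv_ge0 -scalerBl scalev_ge0// subr_ge0.
Qed.

Lemma joinvDr x y z : join x y + z = join (x + z) (y + z).
Proof.
apply/le_anti/andP; split; last by rewrite leUx !levD2r leUl leUr.
by rewrite -levBrDr leUx !levBrDr leUl leUr.
Qed.

Definition ppart x := join x 0.

Lemma ppart_ge0 x : 0 <= ppart x. Proof. exact: leUr. Qed.

Lemma ppart_ge x : x <= ppart x. Proof. exact: leUl. Qed.

Lemma ppart_le x y : (ppart x <= y) = (x <= y) && (0 <= y).
Proof. exact: leUx. Qed.

Lemma ppartD x y : ppart (x + y) <= ppart x + ppart y.
Proof. by rewrite ppart_le levD ?ppart_ge// addv_ge0 ?ppart_ge0. Qed.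

Lemma ppart_id x : 0 <= x -> ppart x = x.
Proof. by move=> x0; apply/le_anti; rewrite ppart_le lexx x0 ppart_ge. Qed.

Lemma ppartB x : ppart x - ppart (- x) = x.
Proof.
have : ppart x - x = ppart (- x).
  by rewrite /ppart joinvDr subrr sub0r joinC.
by move=> <-; rewrite opprB addrC subrK.
Qed.

Lemma ppart_join x y : ppart (join x y) <= ppart x + ppart y.
Proof.
rewrite ppart_le leUx addv_ge0 ?ppart_ge0// andbT.
by rewrite -{1}[x]addr0 -{2}[y]add0r !levD ?ppart_ge0 ?ppart_ge.
Qed.

Lemma le_modulus x : x <= modulus x. Proof. exact: leUl. Qed.

Lemma oppv_le_modulus x : - x <= modulus x. Proof. exact: leUr. Qed.

Lemma modulus_le x y : (modulus x <= y) = (x <= y) && (- x <= y).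
Proof. exact: leUx. Qed.

Lemma modulus_ge0 x : 0 <= modulus x.
Proof.
have : 0 <= modulus x + modulus x.
  by rewrite -(subrr x) levD ?le_modulus ?oppv_le_modulus.
move/(@scalev_ge0 2^-1); rewrite invr_ge0 ler0n => /(_ isT).
rewrite scalerDr -scalerDl (_ : 2^-1 + 2^-1 = 1) ?scale1r//.
by field.
Qed.

Lemma modulus_id x : 0 <= x -> modulus x = x.
Proof.
move=> x0; apply/le_anti; rewrite modulus_le lexx le_modulus andbT.
by rewrite (le_trans _ x0)// oppv_le0.
Qed.

Lemma lev_norm_of_modulus x y : modulus x <= modulus y -> `|x| <= `|y|.
Proof. exact: vle_norm. Qed.

Lemma norm_modulus x : `|modulus x| = `|x|.
Proof.
have h : modulus (modulus x) = modulus x by rewrite modulus_id ?modulus_ge0.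
by apply/le_anti; rewrite !lev_norm_of_modulus ?h.
Qed.

Lemma lev_norm x y : 0 <= x -> x <= y -> `|x| <= `|y|.
Proof.
move=> x0 xy; apply: lev_norm_of_modulus.
by rewrite !modulus_id// (le_trans x0).
Qed.

(** The norm of [ppart (x - y)] measures how far [x <= y] fails; order bounds on a difference become
    norm bounds on this defect. *)
Lemma norm_ppart_le x y : x <= y -> `|ppart x| <= `|y|.
Proof.
move=> xy; rewrite -(norm_modulus y); apply: lev_norm; first exact: ppart_ge0.
by rewrite ppart_le modulus_ge0 andbT (le_trans xy)// le_modulus.
Qed.

Lemma norm_ppart x : `|ppart x| <= `|x|. Proof. exact: norm_ppart_le. Qed.

Lemma norm_ppartD x y : `|ppart (x + y)| <= `|ppart x| + `|ppart y|.
Proof.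
by apply: le_trans (ler_normD _ _); rewrite lev_norm ?ppart_ge0 ?ppartD.
Qed.

Lemma norm_le_ppart x : `|x| <= `|ppart x| + `|ppart (- x)|.
Proof. by rewrite -{1}(ppartB x) ler_normB. Qed.

Lemma ppart_eq0 x : `|ppart x| <= 0 -> x <= 0.
Proof. by rewrite normr_le0 => /eqP <-; exact: ppart_ge. Qed.

(** From [0 <= u n] follows [- l <= u n - l], so the norm of [ppart (- l)] is at most that of
    [l - u n], which is arbitrarily small. *)
Lemma limv_ge0 (u : nat -> E) (l : E) :
  u n @[n --> \oo] --> l -> (\forall n \near \oo, 0 <= u n) -> 0 <= l.
Proof.
move=> ul u0; rewrite -oppv_le0; apply: ppart_eq0.
apply/ler_addgt0Pl => e e0; rewrite addr0.
move/cvgrPdist_le : ul => /(_ _ e0) ul.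
have [n [un0 une]] : exists n, 0 <= u n /\ `|l - u n| <= e.
  by near \oo => n; exists n; split; near: n.
apply: le_trans une; rewrite -[leRHS]normrN opprB; apply: norm_ppart_le.
by rewrite -{1}[- l]add0r levD2r.
Unshelve. all: by end_near. Qed.

Lemma ler_limv (u v : nat -> E) (l m : E) :
  u n @[n --> \oo] --> l -> v n @[n --> \oo] --> m ->
  (\forall n \near \oo, u n <= v n) -> l <= m.
Proof.
move=> ul vm uv; rewrite -subv_ge0; apply: (@limv_ge0 (fun n => v n - u n)).
  exact: cvgB.
by apply: filterS uv => n; rewrite subv_ge0.
Qed.

Lemma limv_le (u : nat -> E) (l y : E) :
  u n @[n --> \oo] --> l -> (\forall n \near \oo, u n <= y) -> l <= y.
Proof. by move=> ul; apply: ler_limv ul _; exact: cvg_cst. Qed.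

Lemma limv_ge (u : nat -> E) (l y : E) :
  u n @[n --> \oo] --> l -> (\forall n \near \oo, y <= u n) -> y <= l.
Proof. by move=> ul; apply: ler_limv _ ul; exact: cvg_cst. Qed.

Lemma nondecreasing_limv_ge (u : nat -> E) (l : E) n :
  nondecreasing_seq u -> u n @[n --> \oo] --> l -> u n <= l.
Proof.
move=> iu ul; apply: limv_ge ul _; exists n => // m /= nm; exact: iu.
Qed.

Lemma KB_nondecreasing (u : nat -> E) (a b : E) : KB_space E ->
  nondecreasing_seq u -> (forall n, a <= u n <= b) -> cvg (u n @[n --> \oo]).
Proof.
move=> kb iu ub.
have : cvg ((u n - a) @[n --> \oo]).
  apply: (kb (fun n => u n - a)).
  - by move=> n; rewrite subv_ge0; case/andP: (ub n).
  - by move=> n m nm; rewrite levD2r iu.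
  - exists `|b - a|; split; first exact: num_real.
    move=> M bM n _ /=; apply: le_trans (ltW bM).
    by rewrite lev_norm ?subv_ge0 ?levD2r; case/andP: (ub n).
move=> /cvg_ex[l ul]; apply/cvg_ex; exists (l + a).
have -> : u = (fun n => u n - a + a) by apply/funext => n; rewrite subrK.
by apply: cvgD ul _; exact: cvg_cst.
Qed.

Lemma KB_nonincreasing (u : nat -> E) (a b : E) : KB_space E ->
  nonincreasing_seq u -> (forall n, a <= u n <= b) -> cvg (u n @[n --> \oo]).
Proof.
move=> kb iu ub.
have /cvg_ex[l ul] : cvg (- u n @[n --> \oo]).
  apply: (@KB_nondecreasing _ (- b) (- a)) => //.
  - by move=> n m nm; rewrite levN2 iu.
  - by move=> n; rewrite !levN2 andbC ub.
apply/cvg_ex; exists (- l).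
have -> : u = (fun n => - - u n) by apply/funext => n; rewrite opprK.
exact: cvgN.
Qed.

End VectorLattice.

(** * Positive functionals on KB-spaces *)

Section PositiveFunctionals.
Context {R : realType} {E : banachLatticeType R}.
Local Notation join := Order.join.

(* This single inequality makes [f] positive and [C]-bounded. *)
Definition ppart_dominated (f : E -> R) (C : R) :=
  forall x : E, f x <= C * `|ppart x|.

Lemma ppart_dominated_ge0 (f : {linear E -> R^o}) C x :
  ppart_dominated f C -> 0 <= x -> 0 <= f x.
Proof.
move=> fC x0; have := fC (- x); rewrite linearN /=.
have -> : ppart (- x) = 0.
  by apply/le_anti; rewrite ppart_ge0 ppart_le lexx oppv_le0 x0.
by rewrite normr0 mulr0 oppr_le0.
Qed.

Lemma ppart_dominated_le (f : {linear E -> R^o}) C x y :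
  ppart_dominated f C -> x <= y -> f x <= f y.
Proof.
move=> fC; rewrite -subv_ge0 => /(ppart_dominated_ge0 fC).
by rewrite linearB subr_ge0.
Qed.

Lemma ppart_dominated_norm (f : {linear E -> R^o}) C x : 0 <= C ->
  ppart_dominated f C -> `|f x : R| <= C * `|x|.
Proof.
move=> C0 fC; rewrite ler_norml lerNl; apply/andP; split.
  have := fC (- x); rewrite linearN => /le_trans; apply.
  by rewrite ler_wpM2l// (le_trans (norm_ppart _))// normrN.
by apply: le_trans (fC x) _; rewrite ler_wpM2l// norm_ppart.
Qed.

Lemma sublinear_norm_ppart : sublinear (fun x : E => `|ppart x|).
Proof.
split=> [x y|a x a0]; first exact: norm_ppartD.
rewrite -{2}(ger0_norm a0) -normrZ; apply: lev_norm; first exact: ppart_ge0.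
by rewrite ppart_le levZ2l ?ppart_ge//= scalev_ge0 ?ppart_ge0.
Qed.

(** Hahn-Banach is applied with the norm of the positive part in place of the norm, which makes the
    functional positive. *)
Lemma norming_functional (x : E) :
  exists2 f : {linear E -> R^o}, ppart_dominated f 1 & `|ppart x| <= f x.
Proof.
have [||y ->//|f [fp fx]] :=
  @hahn_banach R E _ [set x] `|ppart x| sublinear_norm_ppart.
- by move=> t y z _ /= -> ->; rewrite -scalerDl addrC subrK scale1r.
- by exists x.
by exists f; [move=> y; rewrite mul1r; exact: fp|exact: fx].
Qed.

Definition tail_join (v : nat -> E) (n j : nat) : E :=
  iteri j (fun i y => join y (v (n + i).+1)) (v n).

Lemma le_tail_joinS v n j : tail_join v n.+1 j <= tail_join v n j.+1.
Proof.
elim: j => [|j IH]; first by rewrite /tail_join /= addn0 leUr.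
rewrite [leLHS]/= [leRHS]/= leUx (le_trans IH) ?leUl//=.
by rewrite addSnnS leUr.
Qed.

Lemma tail_join_le v n j y : (forall k, v k <= y) -> tail_join v n j <= y.
Proof. by move=> vy; elim: j => [|j IH] //=; rewrite leUx IH vy. Qed.

Lemma tail_join_nondecreasing v n : nondecreasing_seq (tail_join v n).
Proof. by apply/nondecreasing_seqP => j; rewrite leUl. Qed.

(** A join of positive vectors lies below their sum, and the right-hand side is the exact sum of the
    geometric bounds from [n] to [n + j]. *)
Lemma functional_tail_join_le (f : {linear E -> R^o}) C (v : nat -> E) d n j :
  ppart_dominated f C -> (forall k, 0 <= v k) ->
  (forall k, (n <= k)%N -> f (v k) <= d / 2 ^+ k) ->
  f (tail_join v n j) <= 2 * (d / 2 ^+ n) - d / 2 ^+ (n + j).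
Proof.
move=> fC v0 fv; elim: j => [|j IH].
  by rewrite addn0; apply: le_trans (fv n (leqnn n)) _; lra.
have h : join (tail_join v n j) (v (n + j).+1) <=
    tail_join v n j + v (n + j).+1.
  have tj0 : 0 <= tail_join v n j.
    exact: le_trans (v0 n) (tail_join_nondecreasing v n (leq0n j)).
  by rewrite leUx -{1}[tail_join v n j]addr0 -{2}[v _]add0r levD2l levD2r v0.
apply: le_trans (ppart_dominated_le fC h) _; rewrite linearD /=.
apply: le_trans (lerD IH (fv _ _)) _; first by rewrite leqW ?leq_addr.
rewrite addnS; have -> : d / 2 ^+ (n + j).+1 = d / 2 ^+ (n + j) / 2.
  by rewrite exprSr invfM mulrA.
by lra.
Qed.

(** If no functional works, choose [v k] in the interval, of norm at least [e], on which the sum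
    [F k] of the norming functionals of the earlier terms is below [dlt k]. With [V n] the supremum
    of the tail from [n], the norming functional of [v n] is at least [e] at [V n] but at most
    [e / 2] at [V n.+1]. So consecutive terms of [V] stay [e / 2] apart, although [V] decreases and
    hence converges. *)
Lemma KB_functional_eps (u : E) (e : R) : KB_space E -> 0 <= u -> 0 < e ->
  exists (f : {linear E -> R^o}) (C d : R), [/\ 0 <= C, ppart_dominated f C,
    0 < d & forall v, 0 <= v <= u -> f v < d -> `|v| < e].
Proof.
move=> kb u0 e0; apply: contrapT => H.
have {}H (f : {linear E -> R^o}) (C d : R) : 0 <= C -> ppart_dominated f C ->
    0 < d -> exists v : E, [/\ 0 <= v <= u, f v < d & e <= `|v|].
  move=> C0 fC d0; apply: contrapT => Hv; apply: H; exists f, C, d.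
  split=> // v uv fv; rewrite ltNge; apply/negP => ev.
  by apply: Hv; exists v.
pose dlt k : R := (e / 4) / 2 ^+ k.
have dlt0 k : 0 < dlt k by rewrite !divr_gt0// exprn_gt0.
(* The choice ranges over all functionals, with domination as a premise and [0] as default, because
   [F] is defined by recursion before its values are known to be dominated. *)
have /choice[c cP] : forall fk : {linear E -> R^o} * nat, exists w : E,
    (exists2 C, 0 <= C & ppart_dominated fk.1 C) ->
    [/\ 0 <= w <= u, fk.1 w < dlt fk.2 & e <= `|w|].
  move=> [f k] /=.
  have [[C C0 fC]|no] := pselect (exists2 C, 0 <= C & ppart_dominated f C).
    by have [v ?] := H _ _ _ C0 fC (dlt0 k); exists v.
  by exists 0 => /no.
have /choice[h hP] : forall v : E, exists f : {linear E -> R^o},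
    ppart_dominated f 1 /\ `|ppart v| <= f v.
  by move=> v; have [f ? ?] := norming_functional v; exists f.
pose F := fix F k : {linear E -> R^o} :=
  if k is k'.+1 then (F k' \+ h (c (F k', k')) : E -> R^o) else \0.
pose v k := c (F k, k).
have FC k : exists2 C, 0 <= C & ppart_dominated (F k) C.
  elim: k => [|k [C C0 FC]]; first by exists 0 => // x; rewrite mul0r.
  exists (C + 1); first by rewrite addr_ge0.
  by move=> x /=; rewrite mulrDl lerD// (hP _).1.
have vP k : [/\ 0 <= v k <= u, F k (v k) < dlt k & e <= `|v k|].
  exact: (cP (F k, k) (FC k)).
have v0 k : 0 <= v k by case: (vP k) => /andP[].
have vu k : v k <= u by case: (vP k) => /andP[].
have hF n k x : (n < k)%N -> 0 <= x -> h (v n) x <= F k x.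
  move=> nk x0; elim: k nk => // k IH; rewrite ltnS leq_eqVlt => /orP[/eqP <-|].
    have [C C0 FnC] := FC n.
    by rewrite /= lerDr (ppart_dominated_ge0 FnC).
  move=> /IH /le_trans; apply; rewrite /= lerDl.
  by apply: ppart_dominated_ge0 (hP _).1 _.
have tcvg n : cvg (tail_join v n j @[j --> \oo]).
  apply: (@KB_nondecreasing _ _ _ 0 u kb); first exact: tail_join_nondecreasing.
  move=> j; rewrite tail_join_le// andbT (le_trans (v0 n))//.
  exact: (tail_join_nondecreasing v n (leq0n j)).
have /choice[V VP] : forall n, exists l : E, tail_join v n j @[j --> \oo] --> l.
  by move=> n; exact/cvg_ex.
have Vv n : v n <= V n.
  exact: (nondecreasing_limv_ge 0 (@tail_join_nondecreasing v n) (VP n)).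
have VS n : V n.+1 <= V n.
  apply: limv_le (VP n.+1) _; near=> j.
  apply: le_trans (le_tail_joinS v n j) _.
  exact: nondecreasing_limv_ge (@tail_join_nondecreasing v n) (VP n).
have hV n : h (v n) (V n.+1) <= e / 2.
  have hc : h (v n) (tail_join v n.+1 j) @[j --> \oo] --> (h (v n) (V n.+1) : R).
    apply/cvgrPdist_lt => d d0; have /cvgrPdist_lt/(_ _ d0) := VP n.+1.
    apply: filterS => j; apply: le_lt_trans; rewrite -linearB.
    by rewrite -[leRHS]mul1r; apply: ppart_dominated_norm (hP _).1.
  rewrite -(cvg_lim (@Rhausdorff R) hc); apply: limr_le.
    by apply/cvg_ex; eexists; exact: hc.
  near=> j; apply: le_trans (functional_tail_join_le (d := e / 4) _ (hP _).1 v0 _) _.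
    move=> k nk; apply: le_trans (hF _ _ _ nk (v0 k)) _.
    by apply: ltW; case: (vP k).
  have := dlt0 (n.+1 + j)%N; have : dlt n.+1 <= e / 4.
    by rewrite ler_pdivrMr ?exprn_gt0// ler_peMr ?divr_ge0 ?(ltW e0)// exprn_ege1// ler1n.
  rewrite /dlt; lra.
have V0 n : 0 <= V n by rewrite (le_trans _ (Vv n)).
have Vu n : V n <= u.
  by apply: limv_le (VP n) _; near=> j; exact: tail_join_le.
have /cvg_ex[l /cvgrPdist_lt Vl] : cvg (V n @[n --> \oo]).
  apply: (@KB_nonincreasing _ _ _ 0 u kb); first exact/nonincreasing_seqP.
  by move=> n; rewrite V0 Vu.
have [N _ HN] := Vl (e / 4) (divr_gt0 e0 (ltr0n _ 4)).
have VN : `|V N - V N.+1| < e / 2.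
  have := HN N (leqnn N); have := HN N.+1 (leqnSn N); rewrite /= => h1 h2.
  have -> : V N - V N.+1 = (l - V N.+1) - (l - V N).
    by rewrite opprB [RHS]addrC addrA subrK.
  by apply: le_lt_trans (ler_normB _ _) _; lra.
have := ppart_dominated_norm (V N - V N.+1) ler01 (hP (v N)).1.
rewrite mul1r linearB /= => /(le_trans (ler_norm _)).
have := hV N; have [_ _ eN] := vP N; have := (hP (v N)).2.
have := ppart_dominated_le (hP (v N)).1 (Vv N); rewrite ppart_id//; lra.
Unshelve. all: by end_near. Qed.
End PositiveFunctionals.

Lemma cauchy_sequence_cvg {R : realType} {X : completeNormedModType R}
    (u : nat -> X) :
  (forall e : R, 0 < e -> exists N, forall n, (N <= n)%N -> `|u N - u n| < e) ->
  cvg (u n @[n --> \oo]).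
Proof.
move=> uC; apply: cauchy_cvg; apply: cauchy_exP => e e0.
have [N HN] := uC e e0; exists (u N); exists N => // n /= /HN.
by rewrite -ball_normE.
Qed.

(** * A single functional controlling the norm on an order interval *)

Section AdditiveNorm.
Context {R : realType} {E : banachLatticeType R}.
Local Notation join := Order.join.

(** Scale the functionals for the tolerances [j.+1%:R^-1] to bounds that sum to at most 1, and add
    them. On the cone the sum dominates each summand, so it serves every tolerance. *)
Lemma KB_functional (u : E) : KB_space E -> 0 <= u ->
  exists2 f : {linear E -> R^o}, ppart_dominated f 1 &
    forall e : R, 0 < e -> exists2 d : R, 0 < d &
      forall v, 0 <= v <= u -> f v < d -> `|v| < e.
Proof.
move=> kb u0.
have /choice[g gP] : forall j : nat, exists g : {linear E -> R^o},
    ppart_dominated g (2^-1 ^+ j.+1) /\ exists2 d : R, 0 < d &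
      forall v, 0 <= v <= u -> g v < d -> `|v| < j.+1%:R^-1.
  move=> j; have [|f [C [d [C0 fC d0 fd]]]] :=
    @KB_functional_eps _ _ u j.+1%:R^-1 kb u0; first by rewrite invr_gt0.
  have C1 : 0 < C + 1 by rewrite ltr_wpDl.
  pose c : R := 2^-1 ^+ j.+1 / (C + 1).
  have c0 : 0 < c by rewrite divr_gt0// exprn_gt0// invr_gt0.
  exists (c \*: f : E -> R^o); split=> [x|].
    rewrite /= -[leLHS]/(c * f x).
    apply: le_trans (ler_wpM2l (ltW c0) (fC x)) _.
    rewrite mulrA ler_wpM2r// /c -mulrA ler_piMr ?exprn_ge0 ?invr_ge0//.
    by rewrite mulrC ler_pdivrMr// mul1r lerDl.
  exists (c * d) => [|v uv]; first exact: mulr_gt0.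
  by rewrite /= -[ltLHS]/(c * f v) ltr_pM2l//; exact: fd.
pose s x : R^nat := series (fun j => g j x : R).
have half1 : 2^-1 != 1 :> R by rewrite invr_eq1 pnatr_eq1.
have geoE n : series (geometric 2^-1 2^-1) n = 1 - 2^-1 ^+ n :> R.
  by rewrite geometric_seriesE//=; field.
have scvg x : cvgn (s x).
  apply: normed_cvg; apply: (@series_le_cvg _ _ (fun j => `|x| * geometric 2^-1 2^-1 j)).
  - by move=> n; exact: normr_ge0.
  - by move=> n /=; rewrite !mulr_ge0 ?exprn_ge0 ?invr_ge0.
  - move=> n /=; rewrite -exprS mulrC; apply: ppart_dominated_norm (gP n).1.
    by rewrite exprn_ge0 ?invr_ge0.
  - apply: (@is_cvg_seriesZ R (geometric 2^-1 2^-1) `|x|).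
    by apply: is_cvg_geometric_series; rewrite ger0_norm ?invr_ge0//; lra.
pose F x : R^o := limn (s x).
have FL : linear F.
  move=> a x y; rewrite /F.
  have -> : s (a *: x + y) = a *: s x + s y.
    apply/funext => n; rewrite /s /series /= -[RHS]/(a *: _ + _).
    rewrite scaler_sumr -big_split/=; apply: eq_bigr => i _.
    by rewrite linearD linearZ.
  rewrite limD//; last by apply: is_cvgZl_tmp.
  by rewrite limZl_tmp.
pose fl := GRing.isLinear.Build R E R^o *:%R F FL.
pose f : {linear E -> R^o} := HB.pack F fl.
exists f.
  move=> x; apply: limr_le => //; apply: nearW => n.
  rewrite mul1r; apply: (@le_trans _ _ (\sum_(0 <= j < n) 2^-1 ^+ j.+1 * `|ppart x|)).
    by apply: ler_sum => j _; exact: (gP j).1.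
  rewrite -mulr_suml ler_piMl//.
  have := geoE n; rewrite /series /=; under eq_bigr do rewrite -exprS.
  by move=> ->; rewrite lerBlDr lerDl exprn_ge0// invr_ge0.
move=> e e0.
have [j je] : exists j : nat, j.+1%:R^-1 < e.
  by have [N _ /(_ N (leqnn N))] := near_infty_natSinv_lt (PosNum e0); exists N.
have [d d0 dP] := (gP j).2; exists d => // v uv fv.
apply: lt_trans je; apply: dP => //; apply: le_lt_trans fv.
have v0 : 0 <= v by case/andP: uv.
have gv i : 0 <= (g i v : R) by exact: ppart_dominated_ge0 (gP i).1 v0.
apply: le_trans (nondecreasing_cvgn_le _ (scvg v) j.+1).
  by rewrite /s /series /= big_nat_recr//= lerDr sumr_ge0.
by apply/nondecreasing_seqP => n; rewrite /s /series /= big_nat_recr//= lerDl.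
Qed.

End AdditiveNorm.

(** * Convex combinations in order intervals *)

Section QuadraticEnergy.
Context {R : realType} {E : banachLatticeType R}.
Context (u : E) (f : {linear E -> R^o}).
Hypotheses (u0 : 0 <= u) (f0 : ppart_dominated f 1).
Local Notation join := Order.join.

Definition tangent (l : R) (v : E) : E := (2 * l) *: v - (l ^+ 2) *: u.

(* In a function lattice with [u = 1], [2lv - l^2u] is tangent to [v^2]: the
   finite joins below approximate the square of [v] from below. *)
Definition tangent_join (s : seq R) (v : E) : E :=
  foldr (fun l y => join (tangent l v) y) 0 s.

(** This stands for [f] of the square of [v]; a supremum of reals avoids forming the square as a
    vector. *)
Definition energy (v : E) : R := sup (range (fun s => f (tangent_join s v) : R)).

Lemma tangent0 v : tangent 0 v = 0.
Proof. by rewrite /tangent mulr0 expr0n !scale0r subr0. Qed.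

Lemma tangent_joinP s v y :
  reflect (forall l, l \in 0 :: s -> tangent l v <= y) (tangent_join s v <= y).
Proof.
apply: (iffP idP) => [|H].
  move=> sy l; rewrite inE => /orP[/eqP ->|].
    rewrite tangent0; apply: le_trans sy.
    by elim: s => [|m s IH] //=; rewrite (le_trans IH) ?leUr.
  elim: s sy => // m s IH /=; rewrite leUx inE => /andP[my sy] /orP[/eqP ->//|].
  exact: IH.
elim: s H => [|m s IH] H /=; first by rewrite -(tangent0 v) H// inE eqxx.
rewrite leUx H ?inE ?eqxx ?orbT//=; apply: IH => l ls; apply: H.
by move: ls; rewrite !inE => /orP[->//|->]; rewrite !orbT.
Qed.

(** The slopes match because [l(a+b) + m(a-b) = (l+m)a + (l-m)b], and the multiples of [u] match by
    the parallelogram identity for [l] and [m]. *)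
Lemma tangent_parallelogram l m a b :
  tangent l (2^-1 *: (a + b)) + tangent m (2^-1 *: (a - b)) =
  2^-1 *: (tangent (l + m) a + tangent (l - m) b).
Proof.
rewrite /tangent !scalerDr !scalerN !scalerA.
have -> : 2^-1 * (2 * (l + m)) = 2 * l * 2^-1 + 2 * m * 2^-1 by field.
have -> : 2^-1 * (2 * (l - m)) = 2 * l * 2^-1 - 2 * m * 2^-1 by field.
move: (2 * l * _) (2 * m * _) => p q.
rewrite [RHS]addrACA -[in RHS]opprD -[in RHS]scalerDl.
have -> : 2^-1 * (l + m) ^+ 2 + 2^-1 * (l - m) ^+ 2 = l ^+ 2 + m ^+ 2 by field.
rewrite [LHS]addrACA -[in LHS]opprD -[in LHS]scalerDl; congr (_ - _).
by rewrite addrACA scalerDl scalerBl.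
Qed.

(** A sum of two joins is bounded once every sum of one tangent from each is. The slope 0 is
    prepended to both lists because each join contains [0], the tangent of slope 0. *)
Lemma tangent_join_parallelogram s t a b : exists r r',
  tangent_join s (2^-1 *: (a + b)) + tangent_join t (2^-1 *: (a - b)) <=
  2^-1 *: (tangent_join r a + tangent_join r' b).
Proof.
exists [seq l + m | l <- 0 :: s, m <- 0 :: t].
exists [seq l - m | l <- 0 :: s, m <- 0 :: t].
rewrite -levBrDr; apply/tangent_joinP => l ls.
rewrite levBrDr addrC -levBrDr; apply/tangent_joinP => m mt.
rewrite levBrDr addrC tangent_parallelogram levZ2l ?invr_ge0// levD//.
  move: (le_refl (tangent_join [seq l + m | l <- 0 :: s, m <- 0 :: t] a)).
  by move=> /tangent_joinP; apply; rewrite inE; apply/orP; right;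
    apply/allpairsP; exists (l, m).
move: (le_refl (tangent_join [seq l - m | l <- 0 :: s, m <- 0 :: t] b)).
by move=> /tangent_joinP; apply; rewrite inE; apply/orP; right;
    apply/allpairsP; exists (l, m).
Qed.

(** This rests on [2 * |l| - l ^ 2 <= 1]. *)
Lemma tangent_le l v : modulus v <= u -> tangent l v <= u.
Proof.
move=> vu; rewrite /tangent levBlDr.
have : (2 * l) *: v <= (2 * `|l|) *: u.
  have [l0|l0] := leP 0 l; rewrite ?(ger0_norm l0) ?(ltr0_norm l0).
    by rewrite levZ2l ?mulr_ge0// (le_trans _ vu)// le_modulus.
  rewrite -[2 * l]opprK -mulrN scaleNr -scalerN levZ2l ?mulr_ge0 ?oppr_ge0 ?(ltW l0)//.
  by rewrite (le_trans _ vu)// oppv_le_modulus.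
move=> /le_trans; apply.
rewrite -[X in X + _]scale1r -scalerDl levZ2r//.
have := sqr_ge0 (`|l| - 1); rewrite sqrrB1 real_normK ?num_real//; lra.
Qed.

Lemma energy_has_ub v : modulus v <= u ->
  has_ubound (range (fun s => f (tangent_join s v) : R)).
Proof.
move=> vu; exists (f u) => _ [s _ <-]; apply: ppart_dominated_le f0 _.
by apply/tangent_joinP => l _; exact: tangent_le.
Qed.

Lemma le_energy s v : modulus v <= u -> f (tangent_join s v) <= energy v.
Proof.
move=> vu; apply: ub_le_sup; last by exists s.
exact: energy_has_ub.
Qed.

Lemma energy_le v (c : R) : (forall s, (f (tangent_join s v) : R) <= c) -> energy v <= c.
Proof.
by move=> H; apply: ge_sup; [exists (f (tangent_join [::] v)), [::]|move=> _ [s _ <-]].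
Qed.

Lemma energy_ge0 v : modulus v <= u -> 0 <= energy v.
Proof.
move=> vu; apply: le_trans (le_energy [::] vu).
by rewrite /tangent_join/= linear0.
Qed.

Lemma energy_bound v : modulus v <= u -> energy v <= f u.
Proof.
move=> vu; apply: energy_le => s; apply: ppart_dominated_le f0 _.
by apply/tangent_joinP => l _; exact: tangent_le.
Qed.

Lemma energy_parallelogram a b : modulus a <= u -> modulus b <= u ->
  energy (2^-1 *: (a + b)) + energy (2^-1 *: (a - b)) <=
  2^-1 * (energy a + energy b).
Proof.
move=> au bu; rewrite -lerBrDr; apply: energy_le => s.
rewrite lerBrDr addrC -lerBrDr; apply: energy_le => t.
rewrite lerBrDr addrC; have [r [r' h]] := tangent_join_parallelogram s t a b.
have := ppart_dominated_le f0 h; rewrite linearD linearZ => /le_trans.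
apply; apply: ler_wpM2l; first by rewrite invr_ge0.
by rewrite linearD; apply: lerD; exact: le_energy.
Qed.

(** In function terms, [2l|v| <= v^2 + l^2 u]; the tangents of slopes [l] and [-l] suffice. Small
    energy thus makes [f (modulus v)] small. *)
Lemma functional_modulus_le_energy (l : R) v : 0 < l -> modulus v <= u ->
  2 * l * f (modulus v) <= energy v + l ^+ 2 * f u.
Proof.
move=> l0 vu; apply: le_trans (lerD (le_energy [:: l; - l] vu) (lexx _)).
have -> : 2 * l * f (modulus v) = f ((2 * l) *: modulus v) by rewrite linearZ.
have -> : l ^+ 2 * f u = f (l ^+ 2 *: u) by rewrite linearZ.
have -> : f (tangent_join [:: l; - l] v) + f (l ^+ 2 *: u) =
    f (tangent_join [:: l; - l] v + l ^+ 2 *: u) by rewrite linearD.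
apply: ppart_dominated_le f0 _.
set J := tangent_join _ v; have l2 : 0 < 2 * l by rewrite mulr_gt0.
have JP : forall m, m \in [:: 0; l; - l] -> tangent m v <= J by exact/tangent_joinP.
have h (x : E) : (2 * l) *: x <= J + l ^+ 2 *: u -> x <= (2 * l)^-1 *: (J + l ^+ 2 *: u).
  move=> /(@levZ2l _ _ (2 * l)^-1); rewrite scalerA mulVf ?gt_eqF// scale1r.
  by apply; rewrite invr_ge0 ltW.
have : modulus v <= (2 * l)^-1 *: (J + l ^+ 2 *: u).
  rewrite modulus_le; apply/andP; split; apply: h; rewrite -levBlDr.
    by apply: (JP l); rewrite !inE eqxx orbT.
  rewrite scalerN -scaleNr -mulrN -sqrrN.
  by apply: (JP (- l)); rewrite !inE eqxx !orbT.
move=> /(levZ2l (ltW l2)); rewrite scalerA divff ?gt_eqF// scale1r//.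
Qed.

End QuadraticEnergy.

Section OrderIntervals.
Context {R : realType} {E : banachLatticeType R}.

Lemma modulus_half_sub (u a b : E) : 0 <= a <= u -> 0 <= b <= u ->
  modulus (2^-1 *: (a - b)) <= u.
Proof.
have half_le x y : 0 <= x <= u -> 0 <= y <= u -> 2^-1 *: (x - y) <= u.
  move=> /andP[x0 xu] /andP[y0 yu].
  have u0 : 0 <= u := le_trans x0 xu.
  apply: (@le_trans _ _ (2^-1 *: u)).
    rewrite levZ2l ?invr_ge0// levBlDr (le_trans xu)//.
    by rewrite -[X in X <= _]addr0 levD2l.
  by rewrite -[leRHS]scale1r levZ2r// invf_le1// ler1n.
move=> ha hb; rewrite modulus_le half_le//= -scalerN opprB.
exact: half_le.
Qed.

(* Near-minimisers over [C n] of a uniformly convex energy form a Cauchy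
   sequence. *)
Lemma KB_midpoint_convex_cvg (u : E) (C : nat -> set E) : KB_space E ->
  (forall n, C n !=set0) -> (forall n, C n.+1 `<=` C n) ->
  (forall n a b, C n a -> C n b -> C n (2^-1 *: (a + b))) ->
  (forall n a, C n a -> 0 <= a <= u) ->
  exists2 b : nat -> E, forall n, C n (b n) & cvg (b n @[n --> \oo]).
Proof.
move=> kb C0 CS Cmid Cu.
have u0 : 0 <= u.
  by have [a /Cu/andP[a0 au]] := C0 0; exact: le_trans au.
have [f f0 fstrict] := KB_functional kb u0.
have Cmod n a : C n a -> modulus a <= u.
  by move=> /Cu /andP[a0 au]; rewrite modulus_id.
pose phi := energy u f; pose alpha n := inf [set phi a | a in C n].
have alpha_le n a : C n a -> alpha n <= phi a.
  move=> Ca; apply: ge_inf; last by exists a.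
  by exists 0 => _ [c /Cmod cu <-]; exact: energy_ge0.
have Cne n : [set phi a | a in C n] !=set0.
  by have [a Ca] := C0 n; exists (phi a), a.
have ainc : nondecreasing_seq alpha.
  apply/nondecreasing_seqP => n; apply: lb_le_inf => // _ [a Ca <-].
  exact/alpha_le/CS.
have Cle n m : (n <= m)%N -> C m `<=` C n.
  by move=> /subnK <-; elim: (m - n)%N => // k IH; apply: subset_trans IH; exact: CS.
have acvg : cvgn alpha.
  apply: nondecreasing_is_cvgn => //; exists (f u) => _ [n _ <-].
  have [a Ca] := C0 n; apply: le_trans (alpha_le _ _ Ca) _.
  by apply: energy_bound => //; exact: Cmod Ca.
have /choice[b bP] : forall n, exists b : E, C n b /\ phi b < alpha n + n.+1%:R^-1.
  move=> n; have n0 : 0 < n.+1%:R^-1 :> R by rewrite invr_gt0.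
  have hinf : has_inf [set phi a | a in C n].
    by split=> //; exists 0 => _ [c /Cmod cu <-]; exact: energy_ge0.
  by have [_ [a Ca <-] ha] := inf_adherent n0 hinf; exists a.
exists b; first by move=> n; case: (bP n).
apply: cauchy_sequence_cvg => e e0.
have e2 : 0 < e / 2 by rewrite divr_gt0.
have [d d0 dP] := fstrict _ e2.
have fu0 : 0 <= f u :> R := ppart_dominated_ge0 f0 u0.
(* With this [l], [l * f u < d], so an energy below [l * d] forces [f (modulus v) < d]. *)
pose l : R := d / (f u + 1); have fu1 : 0 < f u + 1 :> R by rewrite ltr_wpDl.
have l0 : 0 < l by rewrite divr_gt0.
have ld : 0 < l * d / 2 by rewrite !mulr_gt0// invr_gt0.
have [N [N1 N2]] : exists N, limn alpha - alpha N < l * d / 2 /\ N.+1%:R^-1 < l * d / 2.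
  have /cvgrPdist_lt/(_ _ ld) h1 := acvg.
  have h2 := near_infty_natSinv_lt (PosNum ld).
  near \oo => N; exists N; split; last by near: N.
  by apply: le_lt_trans (ler_norm _) _; near: N.
exists N => n Nn.
have [CN bN] := bP N; have [Cn bn] := bP n.
set v := 2^-1 *: (b N - b n).
have vu : modulus v <= u by apply: modulus_half_sub; apply: Cu; eassumption.
have Cm := Cmid _ _ _ CN (Cle _ _ Nn _ Cn).
(* The midpoint of [b N] and [b n] lies in [C N], so its energy is at least [alpha N]. The
   parallelogram inequality leaves [phi v] at most half of [limn alpha - alpha N] plus
   [N.+1%:R^-1]. *)
have ev : phi v < l * d.
  have h1 := energy_parallelogram u0 f0 (Cmod _ _ CN) (Cmod _ _ Cn).
  have h2 := alpha_le _ _ Cm.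
  have h3 := nondecreasing_cvgn_le ainc acvg n.
  have h4 : n.+1%:R^-1 <= N.+1%:R^-1 :> R.
    by rewrite lef_pV2 ?posrE// ler_nat.
  move: h1 h2; rewrite -/phi -/v; move: bN bn N1 N2 h3 h4 ld; clear.
  move: (n.+1%:R^-1) (N.+1%:R^-1) (limn alpha) (phi (_ *: _)) (phi v) (l * d).
  move=> x1 x2 x3 x4 x5 x6; lra.
have lfu : l * f u < d by rewrite /l mulrAC ltr_pdivrMr// ltr_pM2l// ltrDl.
clearbody l.
have fv : f (modulus v) < d.
  suff : l * f (modulus v) < l * d by rewrite ltr_pM2l.
  move: lfu (functional_modulus_le_energy u0 f0 l0 vu) ev.
  rewrite -(ltr_pM2l l0) -/phi expr2 -!mulrA.
  have arith (x y z t : R) : y < x -> 2 * z <= t + y -> t < x -> z < x.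
    by lra.
  exact: arith.
have : `|modulus v| < e / 2 by apply: dP; rewrite // vu modulus_ge0.
rewrite norm_modulus /v normrZ ger0_norm ?invr_ge0//; move: `|b N - b n| => x; lra.
Unshelve. all: by end_near. Qed.

End OrderIntervals.

(** * Convex hulls and weak compactness *)

Section ConvexHull.
Context {R : realType}.

(** Two-point combinations replace finite weighted sums, so that properties pass to the hull by
    induction. *)
Inductive convex_hull {V : lmodType R} (S : set V) : set V :=
| convex_hull_base x : S x -> convex_hull S x
| convex_hull_comb (t : R) x y : 0 <= t <= 1 -> convex_hull S x ->
    convex_hull S y -> convex_hull S (t *: x + (1 - t) *: y).

Lemma convex_hull_convex {V : lmodType R} (S : set V) : convex (convex_hull S).
Proof. by move=> t x y; exact: convex_hull_comb. Qed.

Lemma convex_hull_min {V : lmodType R} (S C : set V) : convex C -> S `<=` C ->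
  convex_hull S `<=` C.
Proof.
move=> cC SC x; elim=> {x} [x /SC //|t x y t01 _ Cx _ Cy].
exact: cC.
Qed.

Lemma convex_hull_mono {V : lmodType R} (S S' : set V) : S `<=` S' ->
  convex_hull S `<=` convex_hull S'.
Proof.
move=> SS'; apply: convex_hull_min; first exact: convex_hull_convex.
by move=> x /SS'; exact: convex_hull_base.
Qed.

Lemma half_convex {V : lmodType R} (C : set V) x y : convex C -> C x -> C y ->
  C (2^-1 *: (x + y)).
Proof.
move=> cC Cx Cy; have := cC 2^-1 x y.
have -> : 1 - 2^-1 = 2^-1 :> R by field.
rewrite -scalerDr; apply=> //.
by rewrite invr_ge0 ler0n invf_le1 ?ltr0n// ler1n.
Qed.

Lemma convex_norm_le {V : normedModType R} (t d : R) (x y : V) : 0 <= t <= 1 ->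
  `|x| <= d -> `|y| <= d -> `|t *: x + (1 - t) *: y| <= d.
Proof.
move=> /andP[t0 t1] xd yd; apply: le_trans (ler_normD _ _) _.
rewrite !normrZ ger0_norm// ger0_norm ?subr_ge0//.
have -> : d = t * d + (1 - t) * d by rewrite -mulrDl addrC subrK mul1r.
by rewrite lerD// ler_wpM2l ?subr_ge0.
Qed.

Lemma comb_sub {V : lmodType R} (t : R) (x y x' y' : V) :
  (t *: x + (1 - t) *: y) - (t *: x' + (1 - t) *: y') =
  t *: (x - x') + (1 - t) *: (y - y').
Proof. by rewrite !scalerBr opprD addrACA. Qed.

Lemma comb_cst {V : lmodType R} (t : R) (x : V) : t *: x + (1 - t) *: x = x.
Proof. by rewrite -scalerDl addrC subrK scale1r. Qed.

(** The weights that produce [c] from [g] are reused with [h]. *)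
Lemma convex_hull_near {V : normedModType R} {I : Type} (A : set I)
    (g h : I -> V) (y : V) (d : R) :
  (forall i, A i -> `|h i - g i - y| <= d) ->
  forall c, convex_hull [set g i | i in A] c ->
  exists2 a, convex_hull [set h i | i in A] a & `|a - c - y| <= d.
Proof.
move=> H c; elim=> {c} [_ [i Ai <-]|t c c' t01 _ [a ha ac] _ [a' ha' ac']].
  by exists (h i); [apply: convex_hull_base; exists i|exact: H].
exists (t *: a + (1 - t) *: a'); first exact: convex_hull_comb.
by rewrite comb_sub -{1}(comb_cst t y) comb_sub convex_norm_le.
Qed.

End ConvexHull.

(** * Mazur's lemma for sequences in a weakly compact set *)

Section Mazur.
Context {R : realType} {X : completeNormedModType R}.

Lemma sublinear_norm : sublinear (fun x : X => `|x|).
Proof.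
by split=> [x y|a x a0]; [exact: ler_normD|rewrite normrZ ger0_norm].
Qed.

Lemma le_norm_continuous (f : {linear X -> R^o}) :
  (forall x, f x <= `|x|) -> continuous (f : X -> R^o).
Proof.
move=> fn x; apply/cvgrPdist_lt => e e0.
near=> y; rewrite -linearB; apply: (@le_lt_trans _ _ `|x - y|).
  rewrite ler_norml lerNl -linearN fn andbT.
  by apply: le_trans (fn _) _; rewrite normrN.
near: y; exact: (@cvgr_dist_lt _ _ _ _ _ id x cvg_id).
Unshelve. all: by end_near. Qed.

(** Take for [x] a weak cluster point of [w]. If the hull of some tail stayed farther than [e] from
    [x], a functional below the norm would be at least [e] on every [w i - x] of that tail,
    contradicting clustering. *)
Lemma weakly_compact_convex_hull (W : set X) (w : nat -> X) :
  weakly_compact W -> (\forall n \near \oo, W (w n)) ->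
  exists x, forall k (e : R), 0 < e ->
    exists2 c, convex_hull [set w i | i in [set i | (k <= i)%N]] c &
               `|c - x| <= e.
Proof.
move=> Wc Ww.
pose F : set_system (weak_topology X) := (w : nat -> weak_topology X) n @[n --> \oo].
have [x [_ Fx]] : (W `&` cluster F) !=set0 by apply: Wc.
exists x => k e e0; apply: contrapT => no.
pose C := convex_hull [set w i | i in [set i | (k <= i)%N]].
have [|||f [fp fC]] :=
  @hahn_banach R X _ [set c - x | c in C] e sublinear_norm.
- move=> t _ _ t01 [c Cc <-] [c' Cc' <-].
  exists (t *: c + (1 - t) *: c'); first exact: convex_hull_comb.
  by rewrite -{1}(comb_cst t x) comb_sub.
- by exists (w k - x), (w k) => //; apply: convex_hull_base; exists k => /=.
- move=> _ [c Cc <-]; rewrite leNgt; apply/negP => /ltW ce.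
  by apply: no; exists c.
pose f' : dual X := exist _ f (le_norm_continuous fp).
have fx : nbhs (x : weak_topology X) [set y | `|f x - f y| < e].
  have /cvg_sup/(_ f') h := @cvg_id _ (nbhs (x : weak_topology X)).
  have : nbhs (x : initial_topology (f : X -> R^o)) [set y | `|f x - f y| < e].
    have := @initial_continuous _ _ (f : X -> R^o) x.
    by move=> /cvgrPdist_lt/(_ _ e0).
  exact: (h [set y | `|f x - f y| < e]).
have Fk : F [set w i | i in [set i | (k <= i)%N]].
  by exists k => // n /= kn; exists n.
have [_ [[i ki <-] /=]] := Fx _ _ Fk fx.
rewrite -normrN opprB -linearB => /(le_lt_trans (ler_norm _)).
rewrite ltNge => /negP; apply; apply: fC; exists (w i) => //.
by apply: convex_hull_base; exists i.
Qed.

End Mazur.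

(** * Orbits of LR-sequences *)

Lemma uniform_bound {R : realType} {X : completeNormedModType R}
    (T : nat -> {linear X -> X}) :
  (ereal_sup [set opnorm (T n) | n in [set: nat]] < +oo)%E ->
  exists2 M : R, 0 < M & forall n x, `|T n x| <= M * `|x|.
Proof.
set S := ereal_sup _ => Sfin; pose M := Num.max 1 (fine S).
have MS n y : `|y| <= 1 -> `|T n y| <= M.
  move=> y1; have : (`|T n y|%:E <= S)%E.
    apply: (@le_trans _ _ (opnorm (T n))).
      by apply: ereal_sup_ubound; exists y.
    by apply: ereal_sup_ubound; exists n.
  move=> h; have Sf : S \is a fin_num.
    by rewrite fin_numElt Sfin andbT (lt_le_trans _ h)// ltNyr.
  by move: h; rewrite -(fineK Sf) lee_fin /M le_max => ->; rewrite orbT.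
exists M; first by rewrite lt_max ltr01.
move=> n x; have [->|x0] := eqVneq x 0; first by rewrite linear0 !normr0 mulr0.
have nx : 0 < `|x| by rewrite normr_gt0.
have := MS n (`|x|^-1 *: x); rewrite normrZ normfV normr_id mulVf ?gt_eqF//.
move=> /(_ (lexx _)); rewrite linearZ /= normrZ normfV normr_id.
by rewrite ler_pdivrMl// mulrC.
Qed.

Section Orbits.
Context {R : realType} {E : banachLatticeType R}.
Context (T : nat -> {linear E -> E}) (M : R).
Hypotheses (M0 : 0 < M) (TM : forall n x, `|T n x| <= M * `|x|).
Hypothesis Tright : forall (m : nat) (x : E),
  `|T n (T m x - x)| @[n --> \oo] --> (0 : R).
Hypothesis Tleft : forall (m : nat) (x : E),
  `|T m (T n x) - T n x| @[n --> \oo] --> (0 : R).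
Local Notation join := Order.join.
Local Notation meet := Order.meet.

Lemma operator_cvg m (u : nat -> E) (l : E) :
  u n @[n --> \oo] --> l -> T m (u n) @[n --> \oo] --> T m l.
Proof.
move=> ul; apply/cvgrPdist_lt => e e0.
have /cvgrPdist_lt/(_ (e / M) (divr_gt0 e0 M0)) := ul.
apply: filterS => n; rewrite ltr_pdivlMr// mulrC -linearB.
exact: le_lt_trans (TM _ _).
Qed.

Definition orbit_tail (x : E) (k : nat) : set E :=
  convex_hull [set T n x | n in [set n | (k <= n)%N]].

Lemma orbit_tail_mono x k k' : (k <= k')%N -> orbit_tail x k' `<=` orbit_tail x k.
Proof.
move=> kk'; apply: convex_hull_mono => _ [n k'n <-]; exists n => //.
exact: leq_trans k'n.
Qed.

Lemma orbit_tail_scale c x k a : orbit_tail x k a ->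
  orbit_tail (c *: x) k (c *: a).
Proof.
move: a; apply: convex_hull_min.
  move=> t a b t01 Ca Cb; rewrite /= scalerDr !scalerA ![c * _]mulrC -!scalerA.
  exact: convex_hull_comb.
move=> _ [n kn <-]; rewrite /= -linearZ.
by apply: convex_hull_base; exists n.
Qed.

(* Equivalently, some weak* limit, in the bidual, of convex combinations of the
   tails of [T n x] lies within [r] of [w]. *)
Definition tail_close (x : E) (r : R) := exists w : E, forall k (e : R), 0 < e ->
  exists2 z, orbit_tail x k z & `|z - w| <= r + e.

Lemma tail_close_le x r r' : r <= r' -> tail_close x r -> tail_close x r'.
Proof.
move=> rr' [w H]; exists w => k e /(H k)[z zk zw]; exists z => //.
by apply: le_trans zw _; rewrite lerD2r.
Qed.

(** Replacing [x'] by [x] in a combination from a late tail moves it by nearly [y], so the centre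
    moves by [y] and the radius is kept. *)
Lemma tail_close_shift (x x' y : E) r :
  (T n x - T n x') @[n --> \oo] --> y -> tail_close x' r -> tail_close x r.
Proof.
move=> xx' [w H]; exists (w + y) => k e e0.
have e2 : 0 < e / 2 by rewrite divr_gt0.
have /cvgrPdist_le/(_ _ e2)[k' _ Hk'] := xx'.
have [c ck cw] := H (maxn k k') _ e2.
have [|a ak ac] := @convex_hull_near R E _ _ _ (T^~ x) y (e / 2) _ c ck.
  move=> n /=; rewrite geq_max => /andP[_ k'n].
  by rewrite -normrN opprB; exact: Hk'.
exists a; first by apply: orbit_tail_mono ak; rewrite leq_maxl.
have -> : a - (w + y) = (c - w) + (a - c - y).
  by rewrite [RHS]addrC addrACA subrK -opprD [y + w]addrC.
apply: le_trans (ler_normD _ _) _; move: cw ac; lra.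
Qed.

(** For [z = T m x] this is condition (2) of an LR-sequence, and it is stable under convex
    combinations. *)
Lemma orbit_tail_asymptotic (x z : E) : orbit_tail x 0 z ->
  (T n x - T n z) @[n --> \oo] --> (0 : E).
Proof.
move: z; apply: convex_hull_min => [t a b t01 Ha Hb|_ [m _ <-]] /=.
  have -> : (fun n => T n x - T n (t *: a + (1 - t) *: b)) =
      (fun n => t *: (T n x - T n a) + (1 - t) *: (T n x - T n b)).
    by apply/funext => n; rewrite -comb_sub comb_cst linearD !linearZ.
  by rewrite -(comb_cst t (0 : E)); apply: cvgD; exact: cvgZl_tmp.
apply/norm_cvg0P; rewrite (_ : (fun _ => _) = fun n => `|T n (T m x - x)|).
  exact: Tright.
by apply/funext => n; rewrite linearB -normrN opprB.
Qed.

Section Positive.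
Hypotheses (kb : KB_space E)
  (Tpos : forall (n : nat) (x : E), 0 <= x -> 0 <= T n x).

Lemma operator_mono n x y : x <= y -> T n x <= T n y.
Proof. by rewrite -subv_ge0 => /(Tpos n); rewrite linearB subv_ge0. Qed.

(** The finite meets [c j] of the orbit decrease to a lower bound [l] of it. Since [T n p <= p], the
    defect of [T n p <= T m p] is at most the norm of [T m (T n p) - T n p], which tends to 0. Hence
    [T n p] is eventually nearly below each [c j], while staying above [l]. *)
Lemma subinvariant_cvg p : 0 <= p -> (forall m, T m p <= p) ->
  cvg (T n p @[n --> \oo]).
Proof.
move=> p0 Tp.
pose c j : E := iteri j (fun i y => meet y (T i.+1 p)) (T 0%N p).
have c0 j : 0 <= c j by elim: j => [|j IH] /=; rewrite ?lexI ?IH ?Tpos.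
have cS j : c j.+1 <= c j by exact: leIl.
have cT j : c j <= T j p by case: j => [|j] //=; exact: leIr.
have cp j : c j <= p by exact: le_trans (cT j) (Tp j).
have /cvg_ex[l cl] : cvg (c j @[j --> \oo]).
  apply: (@KB_nonincreasing _ _ _ 0 p) => //; first exact/nonincreasing_seqP.
  by move=> j; rewrite c0 cp.
have lT m : l <= T m p.
  apply: limv_le cl _; exists m => // j /= mj; apply: le_trans (cT m).
  by move: mj => /subnK <-; elim: (j - m)%N => [|k IH] //; exact: le_trans (cS _) IH.
have near_c j : `|ppart (T n p - c j)| @[n --> \oo] --> (0 : R).
  have near_T m : `|ppart (T n p - T m p)| @[n --> \oo] --> (0 : R).
    apply: (squeeze_cvgr _ (cvg_cst 0) (Tleft m p)); apply: nearW => n.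
    rewrite normr_ge0/= -[leRHS]normrN opprB norm_ppart_le//.
    by rewrite levD2l levN2 operator_mono.
  elim: j => [|j IH]; first exact: near_T.
  have h : `|ppart (T n p - c j)| + `|ppart (T n p - T j.+1 p)| @[n --> \oo] --> (0 : R).
    by rewrite -[0]addr0; apply: cvgD IH (near_T _).
  apply: (squeeze_cvgr _ (cvg_cst 0) h); apply: nearW => n.
  rewrite normr_ge0/=; apply: le_trans (ler_normD _ _).
  rewrite lev_norm ?ppart_ge0// ppart_le addv_ge0 ?ppart_ge0// andbT.
  rewrite levBC /= lexI ![_ - (_ + _) <= _]levBC.
  rewrite -[T n p - c j]addr0 -[T n p - T j.+1 p]add0r.
  by rewrite !levD ?ppart_ge0 ?addr0 ?add0r ?ppart_ge.
apply/cvg_ex; exists l; apply/cvgrPdist_le => e e0.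
have e2 : 0 < e / 2 by rewrite divr_gt0.
have /cvgrPdist_le/(_ _ e2)[j _ /(_ j (leqnn j)) cj] := cl.
have /cvgr0Pnorm_le/(_ _ e2) := near_c j.
apply: filterS => n; rewrite normr_id => nj.
rewrite -normrN opprB -[T n p - l]ppart_id ?subv_ge0//.
have -> : T n p - l = (T n p - c j) + (c j - l) by rewrite addrA subrK.
apply: le_trans (norm_ppartD _ _) _; have := norm_ppart (c j - l).
move: cj nj; rewrite -[`|l - _|]normrN opprB; lra.
Qed.

End Positive.
End Orbits.

(** * Subinvariant vectors close to the orbit *)

Section SubinvariantMinorant.
Context {R : realType} {E : banachLatticeType R}.
Context (T : nat -> {linear E -> E}) (M : R).
Hypotheses (kb : KB_space E)
  (Tpos : forall (n : nat) (x : E), 0 <= x -> 0 <= T n x).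
Hypotheses (M0 : 0 < M) (TM : forall n x, `|T n x| <= M * `|x|).
Hypothesis Tleft : forall (m : nat) (x : E),
  `|T m (T n x) - T n x| @[n --> \oo] --> (0 : R).
Local Notation join := Order.join.
Local Notation meet := Order.meet.

Lemma orbit_tail_ge0 x k a : 0 <= x -> orbit_tail T x k a -> 0 <= a.
Proof.
move=> x0; move: a; apply: convex_hull_min => [t a b /andP[t0 t1] a0 b0|].
  by rewrite /= addv_ge0 ?scalev_ge0 ?subr_ge0.
by move=> _ [n _ <-]; exact: Tpos.
Qed.

(** Condition (3) bounds all late orbit terms at once, and the bound survives convex
    combinations. *)
Lemma orbit_tail_almost_invariant x m (a : nat -> E) :
  (forall k, orbit_tail T x k (a k)) ->
  T m (a k) - a k @[k --> \oo] --> (0 : E).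
Proof.
move=> ta; apply/cvgr0Pnorm_le => e e0.
have /cvgr0Pnorm_le/(_ _ e0)[N _ HN] := Tleft m x.
exists N => // k /= Nk; have {ta} := ta k.
move: (a k); apply: convex_hull_min => [t b c t01 Hb Hc|_ [n kn <-]] /=.
  by rewrite linearD !linearZ comb_sub; exact: convex_norm_le.
by have := HN n (leq_trans Nk kn); rewrite normr_id.
Qed.

(** The vector on the left is positive and below [ppart (z - w)]. This trades the centre [w] for
    elements of an order interval at no cost. *)
Lemma norm_sub_meet_ppart (z w : E) : `|z - meet z (ppart w)| <= `|z - w|.
Proof.
apply: le_trans (norm_ppart _); apply: lev_norm; first by rewrite subv_ge0 leIl.
rewrite levBC lexI levBlDr -{1}[z]addr0 levD2l ppart_ge0/=.
by apply: le_trans (ppart_ge w); rewrite levBC ppart_ge.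
Qed.

(* In particular [v] lies below every weak* cluster point of [a] in the bidual. *)
Definition minorant (a : nat -> E) (v : E) :=
  `|ppart (v - a k)| @[k --> \oo] --> (0 : R).

Lemma minorant_join a v v' : minorant a v -> minorant a v' ->
  minorant a (join v v').
Proof.
move=> av av'.
have h : `|ppart (v - a k)| + `|ppart (v' - a k)| @[k --> \oo] --> (0 : R).
  by rewrite -[0]addr0; exact: cvgD.
apply: (squeeze_cvgr _ (cvg_cst 0) h); apply: nearW => k.
rewrite normr_ge0/=; apply: le_trans (ler_normD _ _).
by rewrite lev_norm ?ppart_ge0// joinvDr ppart_join.
Qed.

Lemma minorant_operator a m v : T m (a k) - a k @[k --> \oo] --> (0 : E) ->
  minorant a v -> minorant a (T m v).
Proof.
move=> /norm_cvg0P am av.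
have h : M * `|ppart (v - a k)| + `|T m (a k) - a k| @[k --> \oo] --> (0 : R).
  rewrite -[0]addr0; apply: cvgD => //; rewrite -(mulr0 M).
  by apply: cvgM => //; exact: cvg_cst.
apply: (squeeze_cvgr _ (cvg_cst 0) h); apply: nearW => k.
rewrite normr_ge0/=.
have -> : T m v - a k = T m (v - a k) + (T m (a k) - a k).
  by rewrite linearB addrA subrK.
apply: le_trans (norm_ppartD _ _) _; rewrite lerD ?norm_ppart//.
apply: le_trans (TM m _); apply: norm_ppart_le.
exact: operator_mono (ppart_ge _).
Qed.

Lemma minorant_lim a (v : nat -> E) l : (forall j, minorant a (v j)) ->
  v j @[j --> \oo] --> l -> minorant a l.
Proof.
move=> av vl; apply/cvgr0Pnorm_le => e e0.
have e2 : 0 < e / 2 by rewrite divr_gt0.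
have /cvgrPdist_le/(_ _ e2)[j _ /(_ j (leqnn j)) vj] := vl.
have /cvgr0Pnorm_le/(_ _ e2) := av j.
apply: filterS => k; rewrite !normr_id => h.
have -> : l - a k = (l - v j) + (v j - a k) by rewrite addrA subrK.
apply: le_trans (norm_ppartD _ _) _; have := norm_ppart (l - v j).
by move: vj h => /=; lra.
Qed.

(** Minorants are stable under joins and under each [T m], and positive ones have norm at most
    [B + 1]. Closing [g] under these operations therefore gives an increasing bounded sequence,
    whose limit is [p]. *)
Lemma minorant_subinvariant (a : nat -> E) (B : R) g : 0 <= g ->
  (forall k, `|a k| <= B) ->
  (forall m, T m (a k) - a k @[k --> \oo] --> (0 : E)) ->
  minorant a g ->
  exists p, [/\ g <= p, minorant a p & forall m, T m p <= p].
Proof.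
move=> g0 aB aT ag.
pose step n v : E := iteri n (fun i y => join y (T i v)) v.
have step_ge n v : v <= step n v.
  by elim: n => [|n IH] //=; exact: le_trans IH (leUl _ _).
have step_geT n m v : (m < n)%N -> T m v <= step n v.
  elim: n => // n IH; rewrite ltnS leq_eqVlt => /orP[/eqP ->|/IH h] /=.
    exact: leUr.
  exact: le_trans h (leUl _ _).
have step_min n v : minorant a v -> minorant a (step n v).
  by move=> av; elim: n => //= n IH; apply: minorant_join IH (minorant_operator _ _).
(* [q j.+1] joins [q j] with its images under [T m] for [m < j] only; each [m] is covered from
   [j = m.+1] on, which suffices in the limit. *)
pose q j : E := iteri j step g.
have qmin j : minorant a (q j) by elim: j => //= j; exact: step_min.
have qinc : nondecreasing_seq q by apply/nondecreasing_seqP => j; exact: step_ge.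
have q0 j : 0 <= q j by apply: le_trans g0 (qinc 0 j (leq0n j)).
have qB j : `|q j| <= B + 1.
  have /cvgr0Pnorm_le/(_ _ ltr01)[k _ /(_ k (leqnn k))] := qmin j.
  rewrite /= normr_id => h.
  apply: (@le_trans _ _ `|ppart (q j - a k) + ppart (a k)|).
    rewrite lev_norm// -{1}[q j](subrK (a k)).
    by rewrite levD ?ppart_ge.
  apply: le_trans (ler_normD _ _) _.
  have := norm_ppart (a k); have := aB k; move: h; lra.
have /cvg_ex[p qp] : cvg (q j @[j --> \oo]).
  apply: kb => //; exists (B + 1); split; first exact: num_real.
  by move=> b Bb j _; exact: le_trans (qB j) (ltW Bb).
have qlep j : q j <= p by exact: nondecreasing_limv_ge qp.
exists p; split; first exact: (qlep 0).
  exact: minorant_lim qmin qp.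
move=> m; apply: (limv_le (u := fun j => T m (q j))); first exact: (operator_cvg M0 TM qp).
exists m.+1 => // j /= mj; apply: le_trans (qlep j.+1).
exact: step_geT.
Qed.

Lemma tail_close_subinvariant x r e : 0 <= x -> tail_close T x r -> 0 < e ->
  exists z p, [/\ orbit_tail T x 0 z, cvg (T n p @[n --> \oo]) &
                  `|z - p| <= r + e].
Proof.
move=> x0 [w xw] e0.
have d0 : 0 < e / 3 by rewrite divr_gt0.
(* The three thirds of [e] pay for the distance to [w], for [b k] against its limit [g], and for the
   defect of [p <= a k]. The condition [b <= a] in [C] makes [g] a minorant of [a]. *)
pose c := r + e / 3; pose u := ppart w.
pose C k := [set b : E | 0 <= b <= u /\
  exists2 a, orbit_tail T x k a & b <= a /\ `|a - b| <= c].
have [||||b bC bcvg] := @KB_midpoint_convex_cvg R E u C kb.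
- move=> k; have [z zk zw] := xw k _ d0; exists (meet z u); split.
    by rewrite lexI (orbit_tail_ge0 x0 zk) ppart_ge0 leIr.
  by exists z => //; split; [exact: leIl|exact: le_trans (norm_sub_meet_ppart _ _) zw].
- move=> k b [b0u [a ak ab]]; split=> //; exists a => //.
  exact: orbit_tail_mono ak.
- move=> k b b' [/andP[b0 bu] [a ak [ba ca]]] [/andP[b0' bu'] [a' ak' [ba' ca']]].
  split.
    rewrite scalev_ge0 ?invr_ge0 ?addv_ge0//=.
    have : 2^-1 *: (b + b') <= 2^-1 *: (u + u) by rewrite levZ2l ?invr_ge0// levD.
    by move/le_trans; apply; rewrite scalerDr -scalerDl (_ : 2^-1 + 2^-1 = 1) ?scale1r//; field.
  exists (2^-1 *: (a + a')); first by apply: half_convex => //; exact: convex_hull_convex.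
  split; first by rewrite levZ2l ?invr_ge0// levD.
  rewrite -scalerBr opprD addrACA normrZ ger0_norm ?invr_ge0//.
  have := ler_normD (a - b) (a' - b'); move: ca ca'; lra.
- by move=> k b [].
have /cvg_ex[g bg] := bcvg.
have /choice[a aP] : forall k, exists a : E,
    [/\ orbit_tail T x k a, b k <= a & `|a - b k| <= c].
  by move=> k; have [_ [a ak [ba ca]]] := bC k; exists a.
have ta k : orbit_tail T x k (a k) by case: (aP k).
have ba k : b k <= a k by case: (aP k).
have ca k : `|a k - b k| <= c by case: (aP k).
have g0 : 0 <= g.
  by apply: limv_ge0 bg _; apply: nearW => k; have [/andP[]] := bC k.
have aB k : `|a k| <= c + `|u|.
  rewrite -[a k](subrK (b k)); apply: le_trans (ler_normD _ _) _; rewrite lerD//.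
  by have [/andP[b0 bu] _] := bC k; exact: lev_norm.
have aT m := orbit_tail_almost_invariant m ta.
have ag : minorant a g.
  have h : `|g - b k| @[k --> \oo] --> (0 : R).
    by apply/norm_cvg0P; rewrite -(subrr g); apply: cvgB => //; exact: cvg_cst.
  apply: (squeeze_cvgr _ (cvg_cst 0) h); apply: nearW => k.
  by rewrite normr_ge0/= norm_ppart_le// levD2l levN2.
have [p [gp ap Tp]] := minorant_subinvariant g0 aB aT ag.
have /cvgr0Pnorm_le/(_ _ d0)[k1 _ H1] := ap.
have /cvgrPdist_le/(_ _ d0)[k2 _ H2] := bg.
pose k := maxn k1 k2.
exists (a k), p; split.
- exact: orbit_tail_mono (leq0n k) _ (ta k).
- exact: subinvariant_cvg (le_trans g0 gp) Tp.
have := H1 k (leq_maxl _ _); have := H2 k (leq_maxr _ _); rewrite /= normr_id => h2 h1.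
apply: le_trans (norm_le_ppart _) _; rewrite opprB.
have : `|ppart (a k - p)| <= c + e / 3.
  have : a k - p <= (a k - b k) + (b k - g).
    by rewrite addrA subrK levD2l levN2.
  move=> /norm_ppart_le /le_trans; apply; apply: le_trans (ler_normD _ _) _.
  by rewrite lerD// -normrN opprB.
move: h1; rewrite /c; lra.
Qed.

End SubinvariantMinorant.

(** * Convergence *)

Section Convergence.
Context {R : realType} {E : banachLatticeType R}.
Context (T : nat -> {linear E -> E}) (W : set E) (eta : R).
Hypotheses (Wc : weakly_compact W) (eta0 : 0 <= eta).
Hypothesis TW : forall x : E, unit_ball x ->
  dist (T n x) (ball_enlargement W eta) @[n --> \oo] --> 0%E.

Lemma attractor_sequence (x : E) : `|x| <= 1 ->
  exists w : nat -> E, forall e : R, 0 < e -> exists N, forall n, (N <= n)%N ->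
    W (w n) /\ `|T n x - w n| <= eta + e.
Proof.
move=> x1; pose D n := dist (T n x) (ball_enlargement W eta).
(* The distance is finite only eventually, hence the premise and the default [0]. Dropping the ball
   component from a nearly optimal point costs at most [eta]. *)
have /choice[w wP] : forall n, exists w : E, D n \is a fin_num ->
    W w /\ `|T n x - w| <= eta + (fine (D n) + n.+1%:R^-1).
  move=> n; have [Dn|] := boolP (D n \is a fin_num); last by exists 0.
  have n0 : 0 < n.+1%:R^-1 :> R by rewrite invr_gt0.
  have [_ [_ [w Ww [z z1 <-]] <-] h] := lb_ereal_inf_adherent n0 Dn.
  exists w => _; split=> //.
  have -> : T n x - w = (T n x - (w + eta *: z)) + eta *: z.
    by rewrite opprD addrA subrK.
  apply: le_trans (ler_normD _ _) _; rewrite addrC lerD//.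
    by rewrite normrZ ger0_norm// ler_piMr.
  by apply: ltW; rewrite -lte_fin EFinD fineK.
exists w => e e0; have e2 : 0 < e / 2 by rewrite divr_gt0.
have /fine_cvgP[[N1 _ H1] /cvgrPdist_le/(_ _ e2)[N2 _ H2]] := TW x1.
have [N3 _ H3] := near_infty_natSinv_lt (PosNum e2).
exists (maxn N1 (maxn N2 N3)) => n; rewrite !geq_max => /and3P[n1 n2 n3].
have [Ww h] := wP n (H1 n n1); split=> //; apply: le_trans h _.
have := H2 n n2; have := H3 n n3; rewrite /= sub0r normrN => h3 /(le_trans (ler_norm _)).
rewrite -/(D n); move: h3; set a := n.+1%:R^-1; lra.
Qed.

(** Mazur's lemma supplies the centre from the points of [W] near the orbit of the rescaled vector.
    A free [r > 0] allows [x = 0]; [x] need not be positive, so differences [z - p] are covered. *)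
Lemma attractor_tail_close (x : E) (r : R) : 0 < r -> `|x| <= r ->
  tail_close T x (eta * r).
Proof.
move=> r0 xr; pose y := r^-1 *: x.
have y1 : `|y| <= 1.
  by rewrite normrZ ger0_norm ?invr_ge0 ?(ltW r0)// ler_pdivrMl// mulr1.
have [w wP] := attractor_sequence y1.
have Ww : \forall n \near \oo, W (w n).
  by have [N HN] := wP 1 ltr01; exists N => // n /= /HN[].
have [v vP] := weakly_compact_convex_hull Wc Ww.
exists (r *: v) => k e e0; pose d := e / r / 2.
have d0 : 0 < d by rewrite !divr_gt0.
have [N HN] := wP d d0.
have [c ck cv] := vP (maxn k N) d d0.
have [|a ak ac] := @convex_hull_near R E _ _ _ (T^~ y) 0 (eta + d) _ c ck.
  by move=> n /=; rewrite geq_max subr0 => /andP[_ /HN[]].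
exists (r *: a).
  have -> : x = r *: y by rewrite scalerA divff ?gt_eqF// scale1r.
  by apply: orbit_tail_scale; apply: orbit_tail_mono ak; rewrite leq_maxl.
rewrite -scalerBr normrZ gtr0_norm// mulrC -ler_pdivlMr//.
have -> : a - v = (a - c - 0) + (c - v) by rewrite subr0 addrA subrK.
apply: le_trans (ler_normD _ _) _; apply: le_trans (lerD ac cv) _.
by rewrite mulrDl mulfK ?gt_eqF// -addrA lerD2l /d -splitr.
Qed.

Hypotheses (eta1 : eta < 1) (kb : KB_space E) (TLR : LR_sequence T)
  (Tpos : positive_sequence T).

(** Up to a convergent sequence, the orbit of [x] is that of [z - p], whose norm is at most [r + e];
    the attractor then gives radius [eta * (r + e)]. *)
Lemma tail_close_contract (x : E) (r : R) : 0 <= x -> 0 < r ->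
  tail_close T x r -> tail_close T x ((1 + eta) / 2 * r).
Proof.
move=> x0 r0 xr; have [M M0 TM] := uniform_bound (LR_bounded TLR).
(* This [e] leaves a margin of [(1 - eta) ^ 2 * r / 2] below the target radius. *)
pose e := r * (1 - eta) / 2.
have e0 : 0 < e by rewrite divr_gt0// mulr_gt0// subr_gt0.
have [z [p [zx /cvg_ex[y py] zp]]] :=
  tail_close_subinvariant kb Tpos M0 TM (LR_left TLR) x0 xr e0.
apply: (@tail_close_le _ _ _ _ (eta * (r + e))).
  have : 0 <= (1 - eta) * (1 - eta) * r by rewrite !mulr_ge0 ?subr_ge0 ?ltW.
  rewrite /e; lra.
apply: (@tail_close_shift _ _ T x (z - p) y); last first.
  by apply: attractor_tail_close => //; rewrite addr_gt0.
have -> : (fun n => T n x - T n (z - p)) = (fun n => (T n x - T n z) + T n p).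
  by apply/funext => n; rewrite linearB opprD opprK addrA.
by rewrite -[y]add0r; apply: cvgD => //; exact: (orbit_tail_asymptotic (LR_right TLR) zx).
Qed.

Lemma tail_close_small (x : E) (r : R) : 0 <= x -> 0 < r -> tail_close T x r.
Proof.
move=> x0 r0; pose s := `|x| + 1; have s0 : 0 < s by rewrite ltr_wpDl.
pose q := (1 + eta) / 2; have q0 : 0 < q by rewrite divr_gt0// ltr_pwDl.
have q1 : q < 1 by rewrite /q; move: eta1; lra.
have H n : tail_close T x (q ^+ n * s).
  elim: n => [|n IH]; last first.
    by rewrite exprS -mulrA; apply: tail_close_contract; rewrite ?mulr_gt0 ?exprn_gt0.
  rewrite mul1r; apply: (@tail_close_le _ _ _ _ (eta * s)).
    by rewrite ler_piMl ?ltW.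
  by apply: attractor_tail_close; rewrite // lerDl.
have /cvgr0Pnorm_lt/(_ (r / s) (divr_gt0 r0 s0))[n _ /(_ n (leqnn n))] :
    q ^+ n @[n --> \oo] --> (0 : R).
  by apply: cvg_expr; rewrite gtr0_norm.
move=> /(le_lt_trans (ler_norm _)); rewrite ltr_pdivlMr// => /ltW qr.
exact: tail_close_le qr (H n).
Qed.

Lemma positive_orbit_cvg (x : E) : 0 <= x -> cvg (T n x @[n --> \oo]).
Proof.
move=> x0; have [M M0 TM] := uniform_bound (LR_bounded TLR).
apply: cauchy_sequence_cvg => e e0.
(* Since [z - p] has norm at most [2 * d], the orbits of [z] and [p] differ by at most [e / 4]. The
   limit [y] depends on [e], so only the Cauchy property is obtained. *)
pose d := e / 8 / (M + 1).
have M1 : 0 < M + 1 by rewrite addr_gt0.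
have d0 : 0 < d by rewrite !divr_gt0.
have [z [p [zx /cvg_ex[y py] zp]]] := tail_close_subinvariant kb Tpos M0 TM
  (LR_left TLR) x0 (tail_close_small x0 d0) d0.
have e4 : 0 < e / 8 by rewrite divr_gt0.
have Tzp n : `|T n z - T n p| <= e / 4.
  rewrite -linearB; apply: le_trans (TM n _) _.
  apply: (@le_trans _ _ ((M + 1) * (d + d))).
    by rewrite ler_pM ?(ltW M0)// lerDl.
  rewrite /d mulrDr mulrC divfK ?gt_eqF//; move: e0; lra.
have /cvgr0Pnorm_lt/(_ _ e4)[N1 _ H1] := orbit_tail_asymptotic (LR_right TLR) zx.
have /cvgrPdist_lt/(_ _ e4)[N2 _ H2] := py.
have close n : (maxn N1 N2 <= n)%N -> `|T n x - y| < e / 2.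
  rewrite geq_max => /andP[n1 n2].
  have -> : T n x - y = (T n x - T n z) + (T n z - T n p) + (T n p - y).
    by rewrite !addrA !subrK.
  apply: le_lt_trans (ler_normD _ _) _.
  have := ler_normD (T n x - T n z) (T n z - T n p).
  have := H1 n n1; have := H2 n n2; have := Tzp n.
  by rewrite /= -[`|y - _|]normrN opprB; lra.
exists (maxn N1 N2) => n Nn.
have -> : T (maxn N1 N2) x - T n x = (T (maxn N1 N2) x - y) - (T n x - y).
  by rewrite opprB addrA subrK.
apply: le_lt_trans (ler_normB _ _) _.
have := close n Nn; have := close _ (leqnn _); lra.
Qed.

End Convergence.

Theorem theorem4p1 (R : realType) (E : banachLatticeType R) (e : E)
    (T : nat -> {linear E -> E}) (W : set E) (eta : R) :
  KB_space E ->
  quasi_interior_point e ->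
  LR_sequence T ->
  positive_sequence T ->
  weakly_compact W ->
  0 <= eta < 1 ->
  (forall x : E, unit_ball x ->
     dist (T n x) (ball_enlargement W eta) @[n --> \oo] --> 0%E) ->
  strongly_convergent T.
Proof.
move=> kb _ TLR Tpos Wc /andP[eta0 eta1] TW x.
have pc y : 0 <= y -> cvg (T n y @[n --> \oo]).
  exact: positive_orbit_cvg Wc eta0 TW eta1 kb TLR Tpos y.
have -> : T^~ x = (fun n => T n (ppart x) - T n (ppart (- x))).
  by apply/funext => n; rewrite -linearB ppartB.
by apply: is_cvgB; apply: pc; exact: ppart_ge0.
Qed.
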